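(* Let $L$ be a non-negative integer, $f$ a positive integer, and for non-negative integers $n_1,\dots,n_f$ put $N_i:=n_i+n_{i+1}+\dots+n_f$ for $i=1,\dots,f$. Then \begin{align*} &\sum_{m,n,n_1,\dots,n_f\geq 0}\frac{q^{2m^2+6mn+6n^2+m+3n+N_1^2+\dots+N_f^2+N_1+\dots+N_f}(q;q)_{2L+1}(q;q)_{n_f}}{(q;q)_m(q^3;q^3)_n(q;q)_{L-N_1}(q;q)_{n_f-3n-2m}(q;q)_{n_1}\cdots(q;q)_{n_{f-1}}(q;q)_{2n_f+1}}\\ &\quad+q\sum_{m,n,n_1,\dots,n_f\geq 0}\frac{q^{2m^2+6mn+6n^2+3m+6n+N_1^2+\dots+N_f^2+N_1+\dots+N_f}(q;q)_{2L+1}(q;q)_{n_f}}{(q;q)_m(q^3;q^3)_n(q;q)_{L-N_1}(q;q)_{n_f-3n-2m-1}(q;q)_{n_1}\cdots(q;q)_{n_{f-1}}(q;q)_{2n_f+1}} =\sum_{j=-L}^{L}\left(\frac{j+1}{3}\right)q^{(f+1)(j^2+j)}{2L+1\brack L-j}_q. \end{align*}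
   Context: $(a;p)_n=\prod_{k=0}^{n-1}(1-ap^k)$ for a base $p$. By convention $1/(q;q)_n=0$ for negative integers $n$, so summands with a negative index in a denominator vanish. The $q$-binomial coefficient is ${m+n\brack m}_q=\frac{(q;q)_{m+n}}{(q;q)_m(q;q)_n}$ for $m,n\ge0$ and $0$ otherwise. $\left(\frac{a}{3}\right)$ denotes the Jacobi symbol modulo 3: $0$ if $3\mid a$, $1$ if $a\equiv1\pmod 3$, $-1$ if $a\equiv 2\pmod 3$.
   Formalization: The sum over j on the right runs from -L-1 to L instead of -L to L: as printed the identity fails when 3 does not divide L (for L=f=1 the left side is 1+q+q^2-2q^4, the printed right side 1+q+q^2-q^4); when 3 divides L the two agree. *)

(* Defs.v *)
From mathcomp Require Import all_boot all_order all_algebra.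
From mathcomp Require Import finmap.
From mathcomp Require Import boolp classical_sets functions cardinality fsbigop.

Set Implicit Arguments.
Unset Strict Implicit.
Unset Printing Implicit Defensive.

Import Order.TTheory GRing.Theory Num.Theory.

Local Open Scope classical_set_scope.
Local Open Scope ring_scope.

Definition qpoch (F : fieldType) (a p : F) (n : nat) : F :=
  \prod_(0 <= k < n) (1 - a * p ^+ k).

(* 1/(q;q)_n, with the convention that it is 0 for negative n *)
Definition qfact_inv (F : fieldType) (q : F) (n : int) : F :=
  match n with
  | Posz k => (qpoch q q k)^-1
  | Negz _ => 0
  end.

(* The Gaussian binomial [t over b]: with b = m and t = m + n it is
   (q;q)_(m+n) / ((q;q)_m (q;q)_n) when m and n are natural, 0 otherwise. *)
Definition qbinom (F : fieldType) (q : F) (t b : int) : F :=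
  match b, t - b with
  | Posz m, Posz n => qpoch q q (m + n) / (qpoch q q m * qpoch q q n)
  | _, _ => 0
  end.

Definition jacobi3 (a : int) : int :=
  if (3 %| a)%Z then 0 else if (a == 1 %[mod 3])%Z then 1 else -1.

(* n_i, with the 1-based indexing n_1, ..., n_f *)
Definition part (f : nat) (s : f.-tuple nat) (i : nat) : nat := nth 0%N s i.-1.

(* N_i = n_i + ... + n_f *)
Definition tailsum (f : nat) (s : f.-tuple nat) (i : nat) : nat :=
  (\sum_(i <= k < f.+1) part s k)%N.

Section Summands.
Variables (F : fieldType) (q : F) (L f : nat).

Definition summand1 (m n : nat) (s : f.-tuple nat) : F :=
  q ^+ (2 * m ^ 2 + 6 * m * n + 6 * n ^ 2 + m + 3 * n
        + \sum_(1 <= i < f.+1) tailsum s i ^ 2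
        + \sum_(1 <= i < f.+1) tailsum s i)%N
  * qpoch q q (2 * L + 1) * qpoch q q (part s f)
  / (qpoch q q m * qpoch (q ^+ 3) (q ^+ 3) n)
  * qfact_inv q (L%:Z - (tailsum s 1)%:Z)
  * qfact_inv q ((part s f)%:Z - 3 * n%:Z - 2 * m%:Z)
  / ((\prod_(1 <= i < f) qpoch q q (part s i)) * qpoch q q (2 * part s f + 1)).

Definition summand2 (m n : nat) (s : f.-tuple nat) : F :=
  q ^+ (2 * m ^ 2 + 6 * m * n + 6 * n ^ 2 + 3 * m + 6 * n
        + \sum_(1 <= i < f.+1) tailsum s i ^ 2
        + \sum_(1 <= i < f.+1) tailsum s i)%N
  * qpoch q q (2 * L + 1) * qpoch q q (part s f)
  / (qpoch q q m * qpoch (q ^+ 3) (q ^+ 3) n)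
  * qfact_inv q (L%:Z - (tailsum s 1)%:Z)
  * qfact_inv q ((part s f)%:Z - 3 * n%:Z - 2 * m%:Z - 1)
  / ((\prod_(1 <= i < f) qpoch q q (part s i)) * qpoch q q (2 * part s f + 1)).

End Summands.

Lemma qfact_inv_neg (F : fieldType) (q : F) (n : int) : n < 0 -> qfact_inv q n = 0.
Proof. by case: n. Qed.

Lemma part_le_tailsum1 (f : nat) (s : f.-tuple nat) (i : nat) :
  (0 < i <= f)%N -> (part s i <= tailsum s 1)%N.
Proof.
move=> /andP[i0 lif]; rewrite /tailsum.
have ii : (i \in index_iota 1 f.+1) by rewrite mem_index_iota i0.
by rewrite (big_rem i ii) /= leq_addr.
Qed.

(* The sums over all m, n, n_1, ..., n_f >= 0 are taken with the finitely
   supported \sum_(_ \in _), which is 0 by default on an infinite support; the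
   two lemmas after this one show that the default is not used. *)
Lemma finite_box (L f : nat) : (0 < f)%N ->
  finite_set [set t : nat * nat * f.-tuple nat |
    (tailsum t.2 1 <= L)%N /\ (3 * t.1.2 + 2 * t.1.1 <= part t.2 f)%N].
Proof.
move=> f0.
pose g (u : 'I_L.+1 * 'I_L.+1 * f.-tuple 'I_L.+1) : nat * nat * f.-tuple nat :=
  (val u.1.1, val u.1.2, [tuple of map val u.2]).
apply: (@sub_finite_set _ _ (g @` setT)); last exact/finite_image/finite_finset.
move=> [[m n] s] /= [Ns mn].
have cf : (part s f <= L)%N.
  by apply: leq_trans Ns; apply: part_le_tailsum1; rewrite f0 leqnn.
have mn' : (3 * n + 2 * m <= L)%N by exact: leq_trans mn cf.
have mL : (m < L.+1)%N.
  rewrite ltnS; apply: leq_trans mn'; apply: leq_trans (leq_addl _ _).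
  exact: leq_pmull.
have nL : (n < L.+1)%N.
  rewrite ltnS; apply: leq_trans mn'; apply: leq_trans (leq_addr _ _).
  exact: leq_pmull.
exists (Ordinal mL, Ordinal nL, [tuple of map inord s]) => //.
congr (_, _, _); apply: val_inj; rewrite /= -map_comp -[RHS]map_id.
apply/eq_in_map => x /(nthP 0%N)[i]; rewrite size_tuple => lif <- /=.
rewrite inordK// ltnS; apply: leq_trans Ns.
by apply: (@part_le_tailsum1 _ s i.+1).
Qed.

Lemma finite_summand1 (F : fieldType) (q : F) (L f : nat) : (0 < f)%N ->
  finite_set [set t : nat * nat * f.-tuple nat |
    summand1 q L t.1.1 t.1.2 t.2 != 0].
Proof.
move=> f0; apply: sub_finite_set (finite_box L f0) => -[[m n] s] /= nz.
split; rewrite leqNgt; apply/negP => lt; move: nz; rewrite /summand1.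
  by rewrite (@qfact_inv_neg _ _ (L%:Z - _)) ?subr_lt0// !(mulr0, mul0r) eqxx.
rewrite (@qfact_inv_neg _ _ (_ - 2 * _)) ?(mulr0, mul0r) ?eqxx//.
by rewrite -addrA -opprD subr_lt0 -!PoszM -PoszD.
Qed.

Lemma finite_summand2 (F : fieldType) (q : F) (L f : nat) : (0 < f)%N ->
  finite_set [set t : nat * nat * f.-tuple nat |
    summand2 q L t.1.1 t.1.2 t.2 != 0].
Proof.
move=> f0; apply: sub_finite_set (finite_box L f0) => -[[m n] s] /= nz.
split; rewrite leqNgt; apply/negP => lt; move: nz; rewrite /summand2.
  by rewrite (@qfact_inv_neg _ _ (L%:Z - _)) ?subr_lt0// !(mulr0, mul0r) eqxx.
rewrite (@qfact_inv_neg _ _ (_ - 1)) ?(mulr0, mul0r) ?eqxx//.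
rewrite subr_lt0; apply: lt_trans (ltr01 : (0:int) < 1).
by rewrite -addrA -opprD subr_lt0 -!PoszM -PoszD.
Qed.

(* Main.v *)
Require Import Defs.
From mathcomp Require Import all_boot all_order all_algebra.
From mathcomp Require Import finmap.
From mathcomp Require Import boolp classical_sets functions cardinality fsbigop.
From mathcomp Require Import zify ring.
Set Implicit Arguments.
Unset Strict Implicit.
Import Order.TTheory GRing.Theory Num.Theory.
Local Open Scope classical_set_scope.
Local Open Scope ring_scope.

(** Write [g_L] for the inner double sum over [m, n] with [n_f = L].  The outer sum
    over [n_1, ..., n_f] is [f] applications of the Bailey lemma relative to [a = q],
    each of which multiplies the jth entry of the bilateral sum by [q^(j^2+j)]; this
    reduces the identity to the seed case
      [(q;q)_L g_L = \sum_j (j+1 / 3) q^(j^2+j) [2L+1, L-j]_q].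
    On the right, the q-Pascal rules and the vanishing of the sum of the Jacobi
    symbol over a period couple this bilateral sum [G_L] to
    [E_L = \sum_j ((j / 3) + (j+1 / 3)) q^(j^2) [2L, L-j]_q] by
      [G_L = q^L E_L + (1 - q^(2L)) G_(L-1)] and
      [E_L = q^L G_(L-1) + (1 - q^(2L-1)) E_(L-1)].
    On the left, the shifts [m -> m+1], [n -> n+1] and [L -> L+1] in the double sum give
    contiguous relations from which [(q;q)_L g_L] and a companion [(q;q)_L e_L] satisfy
    the same recurrences.

    Sums are cut off at fixed bounds ([B] for natural indices, [J] for integer ones)
    beyond which all summands vanish; [1/(q;q)_n = 0] for [n < 0] makes the boundary
    terms of the shifts disappear.  No step divides by [q], which may be [0]. *)

(** * Reciprocal q-factorials and the Bailey lemma relative to a = q *)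

Lemma sum_ord_shift (V : nmodType) (B : nat) (h h' : nat -> V) :
  h 0%N = 0 -> (forall m, (m < B)%N -> h m.+1 = h' m) -> h' B = 0 ->
  \sum_(m < B.+1) h m = \sum_(m < B.+1) h' m.
Proof.
move=> h0 hS h'B; rewrite big_ord_recl big_ord_recr /= h0 h'B add0r addr0.
by apply: eq_bigr => m _; rewrite /bump add1n hS.
Qed.

Section QFactorial.
Variables (F : fieldType) (q : F).
Hypothesis hq : forall k : nat, (0 < k)%N -> q ^+ k != 1.

Local Arguments qfact_inv : simpl never.
Local Notation qf := (qfact_inv q).

Lemma qpochS (a p : F) n : qpoch a p n.+1 = qpoch a p n * (1 - a * p ^+ n).
Proof. by rewrite /qpoch big_nat_recr. Qed.

Lemma one_sub_expr_neq0 n : (0 < n)%N -> 1 - q ^+ n != 0.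
Proof. by move=> n0; rewrite subr_eq0 eq_sym hq. Qed.

Lemma qpoch_expr_neq0 d n : (0 < d)%N -> qpoch (q ^+ d) (q ^+ d) n != 0.
Proof.
move=> d0; elim: n => [|n IH]; first by rewrite /qpoch big_geq ?oner_neq0.
by rewrite qpochS mulf_neq0// -exprS -exprM one_sub_expr_neq0 ?muln_gt0 ?d0.
Qed.

Lemma qpochV_rec d n : (0 < d)%N ->
  (1 - q ^+ (d * n.+1)) / qpoch (q ^+ d) (q ^+ d) n.+1
  = (qpoch (q ^+ d) (q ^+ d) n)^-1.
Proof.
move=> d0; have := qpoch_expr_neq0 n.+1 d0; rewrite qpochS -exprS -exprM.
by rewrite mulf_eq0 negb_or => /andP[? ?]; field; apply/andP.
Qed.

Lemma qfact_invE (n : nat) : qf n = (qpoch q q n)^-1. Proof. by []. Qed.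

(** True for every integer n: at n = 0 the factor vanishes together with 1/(q;q)_(-1), and below 0
    both sides are 0. *)
Lemma qfact_inv_rec (n : int) : (1 - q ^ n) * qf n = qf (n - 1).
Proof.
case: n => [[|n]|n]; first by rewrite subrr mul0r.
  have -> : n.+1%:Z - 1 = n by lia.
  by have := @qpochV_rec 1 n isT; rewrite mul1n expr1.
by rewrite (@qfact_inv_neg _ _ (_ - 1)) ?mulr0//; lia.
Qed.

Lemma qfact_inv_recS (n : nat) : (1 - q ^+ n.+1) * qf n.+1 = qf n.
Proof. by have := qfact_inv_rec n.+1; have -> : n.+1%:Z - 1 = n by lia. Qed.

(* The Durfee square form of the q-Vandermonde sum. *)
Lemma q_vandermonde (B M c : nat) : (M <= B)%N ->
  \sum_(s < B.+1) q ^+ (s ^ 2 + c * s) * qf (M%:Z - s%:Z) * qf s * qf (c + s)%N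
  = qf M * qf (M + c)%N.
Proof.
elim: M c => [|M IH] c MB.
  rewrite big_ord_recl big1 => [|s _]; last first.
    by rewrite (@qfact_inv_neg _ _ (_ - _)) ?mulr0 ?mul0r// lift0; lia.
  by rewrite exp0n// muln0 expr0 mul1r subrr !addr0 addn0 qfact_invE
     {2}/qpoch big_geq// invr1 mulr1.
(* Induction on M, for all c, through 1 - q^(M+1) = (1 - q^(M+1-s)) + q^(M+1-s) (1 - q^s). The first
   piece gives the sum for (M, c); the second is [t2], and the shift s -> s+1 turns it into [t3], a
   multiple of the sum for (M, c+1). *)
pose t2 (s : nat) := q ^+ (s ^ 2 + c * s) * q ^ (M.+1%:Z - s%:Z)
  * qf (M.+1%:Z - s%:Z) * qf (s%:Z - 1) * qf (c + s)%N.
pose t3 (s : nat) := q ^+ (M.+1 + c) * (q ^+ (s ^ 2 + c.+1 * s)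
  * qf (M%:Z - s%:Z) * qf s * qf (c.+1 + s)%N).
apply: (mulfI (one_sub_expr_neq0 (ltn0Sn M))).
rewrite mulrA qfact_inv_recS mulr_sumr.
under eq_bigr => s _.
  have -> : (1 - q ^+ M.+1) * (q ^+ (s ^ 2 + c * s) * qf (M.+1%:Z - s%:Z)
      * qf s * qf (c + s)%N) = q ^+ (s ^ 2 + c * s) * qf (M%:Z - s%:Z) * qf s
      * qf (c + s)%N + t2 s.
    have -> : M%:Z - s%:Z = M.+1%:Z - s%:Z - 1 by lia.
    rewrite /t2 -!qfact_inv_rec.
    case: (leqP s M.+1) => sM; last first.
      by rewrite (@qfact_inv_neg _ _ (_ - _)) ?(mulr0, mul0r, addr0)//; lia.
    rewrite subzn// -!exprnP -[in LHS](subnK sM) exprD.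
    by rewrite addnK; ring.
  over.
rewrite big_split /= IH 1?ltnW//.
rewrite (@sum_ord_shift _ _ t2 t3); first last.
- by rewrite /t3 (@qfact_inv_neg _ _ (_ - _)) ?(mulr0, mul0r)//; lia.
- move=> s sB; rewrite /t2 /t3.
  have -> : M.+1%:Z - s.+1%:Z = M%:Z - s%:Z by lia.
  have -> : s.+1%:Z - 1 = s by lia.
  case: (leqP s M) => sM; last first.
    by rewrite (@qfact_inv_neg _ _ (_ - _)) ?(mulr0, mul0r)//; lia.
  rewrite subzn// -!exprnP !mulrA -!exprD.
  by rewrite -[(c + _)%N]addSnnS; do 3 congr (_ * _); congr (_ ^+ _); nia.
- by rewrite /t2 (@qfact_inv_neg _ _ (_ - 1)) ?(mulr0, mul0r)//; lia.
rewrite /t3 -mulr_sumr IH 1?ltnW// addnS !addSn -(qfact_inv_recS (M + c)).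
by ring.
Qed.

(* The Bailey lemma for a = q.  The summand is invariant under j -> -1-j, so the
   case j >= 0 suffices. *)
Lemma bailey_kernel (B L : nat) (j : int) : (L <= B)%N ->
  \sum_(r < B.+1) q ^+ (r ^ 2 + r) * qf (L%:Z - r%:Z)
     * (qf (r%:Z - j) * qf (r%:Z + 1 + j))
  = q ^ (j ^+ 2 + j) * (qf (L%:Z - j) * qf (L%:Z + 1 + j)).
Proof.
move=> LB; wlog j0 : j / 0 <= j => [hw|].
  have [|j0] := leP 0 j; first exact: hw.
  have := hw (- 1 - j); rewrite (_ : (- 1 - j) ^+ 2 + _ = j ^+ 2 + j); last by ring.
  have e (x : int) : (x - (-1 - j) = x + 1 + j) * (x + 1 + (-1 - j) = x - j).
    by split; ring.
  rewrite !e [qf (L%:Z + 1 + j) * _]mulrC => <-; last by lia.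
  by apply: eq_bigr => r _; rewrite !e [X in _ * X]mulrC.
case: j j0 => // j _; case: (leqP j L) => jL; last first.
  rewrite (@qfact_inv_neg _ _ (L%:Z - _)) ?(mulr0, mul0r); last by lia.
  apply: big1 => r _; case: (leqP r L) => rL.
    by rewrite (@qfact_inv_neg _ _ (r%:Z - j%:Z)) ?(mulr0, mul0r)//; lia.
  by rewrite (@qfact_inv_neg _ _ (_ - _)) ?(mulr0, mul0r)//; lia.
(* The terms r < j vanish; r = j + s gives the q-Vandermonde sum with M = L - j and c = 2j + 1. *)
have /q_vandermonde : (L - j <= B - j)%N by lia.
move=> /(_ j.*2.+1) V; rewrite -subzn// in V.
rewrite (_ : B.+1 = (j + (B - j).+1)%N); last by lia.
rewrite big_split_ord /= big1 ?add0r => [|r _]; last first.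
  rewrite (@qfact_inv_neg _ _ (r%:Z - j%:Z)) ?(mulr0, mul0r)//.
  by have := ltn_ord r; lia.
rewrite (_ : L%:Z + 1 + j = (L - j + j.*2.+1)%N); last by lia.
rewrite (_ : j%:Z ^+ 2 + j = (j ^ 2 + j)%N) // -exprnP -V mulr_sumr.
apply: eq_bigr => s _.
rewrite (_ : (j + s)%:Z - j%:Z = s); last by lia.
rewrite (_ : (j + s)%:Z + 1 + j%:Z = (j.*2.+1 + s)%N); last by lia.
rewrite (_ : L%:Z - (j + s)%:Z = L%:Z - j%:Z - s%:Z); last by lia.
rewrite !mulrA -exprD; do 3 congr (_ * _); congr (_ ^+ _); nia.
Qed.
End QFactorial.

(** * Contiguous relations for the double sum over m and n *)

Section DoubleSum.
Variables (F : fieldType) (q : F).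
Hypothesis hq : forall k : nat, (0 < k)%N -> q ^+ k != 1.

Local Arguments qfact_inv : simpl never.
Local Notation qf := (qfact_inv q).

(** The linear exponents [a], [b] are parameters because the shifts of m, k and n stay within this
    family. The two sums of the theorem have (1, 3) at n_f and (3, 6) at n_f - 1; [n] is an integer
    so that it may drop below 0. *)
Definition dterm (a b : nat) (n : int) (m k : nat) : F :=
  q ^+ (2 * m ^ 2 + 6 * m * k + 6 * k ^ 2 + a * m + b * k)
  / (qpoch q q m * qpoch (q ^+ 3) (q ^+ 3) k) * qf (n - 3 * k%:Z - 2 * m%:Z).

Definition dsum (B a b : nat) (n : int) : F :=
  \sum_(m < B.+1) \sum_(k < B.+1) dterm a b n m k.

Lemma dterm_neg a b n m k : n < 3 * k%:Z + 2 * m%:Z -> dterm a b n m k = 0.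
Proof.
by move=> h; rewrite /dterm (@qfact_inv_neg _ _ (_ - _)) ?mulr0//; lia.
Qed.

Lemma dsum_neg B a b n : n < 0 -> dsum B a b n = 0.
Proof.
by move=> n0; rewrite /dsum !big1// => m _; rewrite big1// => k _;
  rewrite dterm_neg//; lia.
Qed.

(** The factor 1 - q^m kills m = 0 and cancels against (q;q)_m; replacing m by m + 1 then adds (4,
    6) to the exponents and lowers n by 2. The bound on [n] makes the summands at the cut-off
    vanish. *)
Lemma dsum_rec_m B a b (n : int) : n <= B%:Z ->
  dsum B a b n - dsum B a.+1 b n = q ^+ (a + 2) * dsum B (a + 4) (b + 6) (n - 2).
Proof.
move=> nB; rewrite /dsum -sumrB mulr_sumr.
rewrite (eq_bigr (fun m : 'I__ => \sum_(k < B.+1) (1 - q ^+ m) * dterm a b n m k)).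
  apply: (@sum_ord_shift _ _
    (fun m => \sum_(k < B.+1) (1 - q ^+ m) * dterm a b n m k)
    (fun m => q ^+ (a + 2) * \sum_(k < B.+1) dterm (a + 4) (b + 6) (n - 2) m k)).
  - by apply: big1 => k _; rewrite expr0 subrr mul0r.
  - move=> m mB; rewrite mulr_sumr; apply: eq_bigr => k _; rewrite /dterm.
    rewrite (_ : n - 3 * k%:Z - 2 * m.+1%:Z = n - 2 - 3 * k%:Z - 2 * m%:Z); last by lia.
    have := @qpochV_rec _ _ hq 1 m isT; rewrite mul1n expr1 => rec.
    rewrite !invfM -rec !mulrA -exprD mulrC !mulrA.
    rewrite [_ * q ^+ _]mulrC -!mulrA; congr (_ * _); last by ring.
    by congr (_ ^+ _); nia.
  - by rewrite big1 ?mulr0// => k _; rewrite dterm_neg//; lia.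
move=> m _; rewrite -sumrB; apply: eq_bigr => k _; rewrite /dterm.
rewrite (_ : (_ + a.+1 * m + b * k)%N
  = (2 * m ^ 2 + 6 * m * k + 6 * k ^ 2 + a * m + b * k + m)%N); last by nia.
by rewrite [q ^+ (_ + m)]exprD; ring.
Qed.

(** The same argument with 1 - q^(3k) and (q^3;q^3)_k, the sum over k being moved outside. *)
Lemma dsum_rec_k B a b (n : int) : n <= B%:Z ->
  dsum B a b n - dsum B a (b + 3) n = q ^+ (b + 6) * dsum B (a + 6) (b + 12) (n - 3).
Proof.
have dsumC a' b' n' : dsum B a' b' n' =
    \sum_(k < B.+1) \sum_(m < B.+1) dterm a' b' n' m k by exact: exchange_big.
move=> nB; rewrite !dsumC -sumrB mulr_sumr.
rewrite (eq_bigr (fun k : 'I__ => \sum_(m < B.+1) (1 - q ^+ (3 * k)) * dterm a b n m k)).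
  apply: (@sum_ord_shift _ _
    (fun k => \sum_(m < B.+1) (1 - q ^+ (3 * k)) * dterm a b n m k)
    (fun k => q ^+ (b + 6) * \sum_(m < B.+1) dterm (a + 6) (b + 12) (n - 3) m k)).
  - by apply: big1 => k _; rewrite muln0 expr0 subrr mul0r.
  - move=> k kB; rewrite mulr_sumr; apply: eq_bigr => m _; rewrite /dterm.
    rewrite (_ : n - 3 * k.+1%:Z - 2 * m%:Z = n - 3 - 3 * k%:Z - 2 * m%:Z); last by lia.
    rewrite !invfM -(@qpochV_rec _ _ hq 3 k isT) !mulrA -exprD mulrC !mulrA.
    rewrite [_ * q ^+ _]mulrC -!mulrA; congr (_ * _); last by ring.
    by congr (_ ^+ _); nia.
  - by rewrite big1 ?mulr0// => k _; rewrite dterm_neg//; lia.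
move=> k _; rewrite -sumrB; apply: eq_bigr => m _; rewrite /dterm.
rewrite (_ : (_ + a * m + (b + 3) * k)%N
  = (2 * m ^ 2 + 6 * m * k + 6 * k ^ 2 + a * m + b * k + 3 * k)%N); last by nia.
by rewrite [q ^+ (_ + 3 * k)]exprD; ring.
Qed.

(** With r = n - 3k - 2m, write q^n = q^(3k+2m) q^r and use q^r/(q;q)_r = 1/(q;q)_r -
    1/(q;q)_(r-1). *)
Lemma dsum_rec_n B a b (n : int) :
  q ^ n * dsum B a b n = dsum B (a + 2) (b + 3) n - dsum B (a + 2) (b + 3) (n - 1).
Proof.
rewrite /dsum -sumrB mulr_sumr; apply: eq_bigr => m _.
rewrite -sumrB mulr_sumr; apply: eq_bigr => k _; rewrite /dterm.
set r := n - 3 * k%:Z - 2 * m%:Z.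
rewrite (_ : n - 1 - 3 * k%:Z - 2 * m%:Z = r - 1); last by rewrite /r; lia.
rewrite -(qfact_inv_rec hq) (_ : n = r + (3 * k + 2 * m)%N); last by rewrite /r; lia.
have [r0|r0] := ltP r 0; first by rewrite qfact_inv_neg// !mulr0 subrr.
rewrite exprzD_ss ?r0// -exprnP.
rewrite (_ : (_ + (a + 2) * m + (b + 3) * k)%N
  = (2 * m ^ 2 + 6 * m * k + 6 * k ^ 2 + a * m + b * k
     + (3 * k + 2 * m))%N); last by nia.
by rewrite [q ^+ (_ + (_ + _))]exprD; ring.
Qed.

Definition gsum B (n : int) : F := dsum B 1 3 n + q * dsum B 3 6 (n - 1).

(* Found by solving [gsum_rec] for [esum] at the level of generating functions. *)
Definition esum B (n : int) : F :=
  dsum B 1 3 n + q ^+ 2 * dsum B 3 6 (n - 2) + q ^+ 6 * dsum B 7 12 (n - 3)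
  - q ^+ 7 * dsum B 7 12 (n - 4).

(* With K(x) the generating function of [dsum _ 1 3] multiplied by (x;q)_oo, this is
   K(x) - K(xq) = (q^3 + q^4) x^2 K(xq^2) + q^9 x^3 (1 - q^2 x) K(xq^4). *)
Lemma dsum_diff B (n : int) : n <= B%:Z ->
  dsum B 1 3 n - dsum B 3 6 n =
  (q ^+ 3 + q ^+ 4) * dsum B 5 9 (n - 2) + q ^+ 9 * dsum B 9 15 (n - 3)
  - q ^+ 11 * dsum B 9 15 (n - 4).
Proof.
move=> nB.
(* Two shifts of m and one of k lead from (1, 3) through (2, 3) and (3, 3) to (3, 6); a third shift
   of m, at n - 2, trades (6, 9) for (5, 9). *)
have r1 := dsum_rec_m 1 3 nB; have r2 := dsum_rec_m 2 3 nB.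
have r3 := dsum_rec_k 3 3 nB.
have nB' : n - 2 <= B%:Z by lia.
have r4 := dsum_rec_m 5 9 nB'.
rewrite (_ : n - 2 - 2 = n - 4) in r4; last by lia.
rewrite ?addn1 /= in r1 r2 r3 r4.
have -> : dsum B 1 3 n = dsum B 2 3 n + q ^+ 3 * dsum B 5 9 (n - 2) by rewrite -r1; ring.
have -> : dsum B 2 3 n = dsum B 3 3 n + q ^+ 4 * dsum B 6 9 (n - 2) by rewrite -r2; ring.
have -> : dsum B 3 3 n = dsum B 3 6 n + q ^+ 9 * dsum B 9 15 (n - 3) by rewrite -r3; ring.
have -> : dsum B 6 9 (n - 2) = dsum B 5 9 (n - 2) - q ^+ 7 * dsum B 9 15 (n - 4).
  by rewrite -r4; ring.
by ring.
Qed.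

(** This is [dsum_rec_n] at n - d, after q^n = q^d q^(n-d). For n < d that splitting could fail at q
    = 0, but both sides vanish. *)
Lemma expz_dsum B a b (n : int) (d : nat) : 0 <= n ->
  q ^ n * dsum B a b (n - d%:Z)
  = q ^+ d * (dsum B (a + 2) (b + 3) (n - d%:Z) - dsum B (a + 2) (b + 3) (n - d%:Z - 1)).
Proof.
move=> n0; have [nd|nd] := leP d%:Z n; last by rewrite !dsum_neg ?subrr ?mulr0//; lia.
rewrite -dsum_rec_n mulrA; congr (_ * _); rewrite exprnP -exprzD_ss; last by lia.
by congr (_ ^ _); lia.
Qed.

(** After [expz_dsum], the sums with exponents (3, 6) and (9, 15) are eliminated by [dsum_diff] at n
    and at n - 1. *)
Lemma expz_esum B (n : int) : 0 <= n <= B%:Z ->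
  q ^ n * esum B n = dsum B 1 3 n - dsum B 1 3 (n - 1)
    - q ^+ 3 * (dsum B 5 9 (n - 2) - dsum B 5 9 (n - 3)).
Proof.
move=> /andP[n0 nB].
have e2 : n - 2 - 1 = n - 3 by lia.
have e3 : n - 3 - 1 = n - 4 by lia.
have e4 : n - 4 - 1 = n - 5 by lia.
have d1 : dsum B 1 3 (n - 1) - dsum B 3 6 (n - 1) =
    (q ^+ 3 + q ^+ 4) * dsum B 5 9 (n - 3) + q ^+ 9 * dsum B 9 15 (n - 4)
    - q ^+ 11 * dsum B 9 15 (n - 5).
  by rewrite -e2 -e3 -e4 !(addrAC n _ (- 1)) dsum_diff//; lia.
have r0 : q ^ n * dsum B 1 3 n = dsum B 3 6 n - dsum B 3 6 (n - 1).
  exact: dsum_rec_n.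
have r2 : q ^ n * dsum B 3 6 (n - 2)
    = q ^+ 2 * (dsum B 5 9 (n - 2) - dsum B 5 9 (n - 3)).
  by rewrite -e2; apply: (expz_dsum B 3 6 2 n0).
have r3 : q ^ n * dsum B 7 12 (n - 3)
    = q ^+ 3 * (dsum B 9 15 (n - 3) - dsum B 9 15 (n - 4)).
  by rewrite -e3; apply: (expz_dsum B 7 12 3 n0).
have r4 : q ^ n * dsum B 7 12 (n - 4)
    = q ^+ 4 * (dsum B 9 15 (n - 4) - dsum B 9 15 (n - 5)).
  by rewrite -e4; apply: (expz_dsum B 7 12 4 n0).
rewrite /esum mulrBr !mulrDr r0 !(mulrCA (q ^ n)) r2 r3 r4.
have /eqP := dsum_diff nB; rewrite subr_eq => /eqP ->.
by move/eqP: d1; rewrite subr_eq => /eqP ->; ring.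
Qed.

(** Counterpart of the recurrence for G: the factor 1 + q^n = (1 - q^(2n))/(1 - q^n) converts
    (q;q)_n/(q;q)_(2n) into (q;q)_(n-1)/(q;q)_(2n-1). *)
Lemma gsum_rec B (n : int) : 0 <= n <= B%:Z ->
  gsum B n = q ^ n * esum B n + (1 + q ^ n) * gsum B (n - 1).
Proof.
move=> nB; have /andP[n0 _] := nB.
have e1 : n - 1 - 1 = n - 2 by lia.
have e2 : n - 2 - 1 = n - 3 by lia.
have r1 : q ^ n * dsum B 1 3 (n - 1) = q * (dsum B 3 6 (n - 1) - dsum B 3 6 (n - 2)).
  by rewrite -e1; apply: (expz_dsum B 1 3 1 n0).
have r2 : q ^ n * dsum B 3 6 (n - 2)
    = q ^+ 2 * (dsum B 5 9 (n - 2) - dsum B 5 9 (n - 3)).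
  by rewrite -e2; apply: (expz_dsum B 3 6 2 n0).
have -> : (1 + q ^ n) * gsum B (n - 1) = gsum B (n - 1)
    + q * (dsum B 3 6 (n - 1) - dsum B 3 6 (n - 2))
    + q * (q ^+ 2 * (dsum B 5 9 (n - 2) - dsum B 5 9 (n - 3))).
  by rewrite -r1 -r2 /gsum e1; ring.
by rewrite expz_esum// /gsum e1; ring.
Qed.

Lemma esum_rec B (n : int) : 0 < n <= B%:Z ->
  (1 - q ^ n) * esum B n
  = q ^ n * gsum B (n - 1) + (1 - q ^ n * q ^ (n - 1)) * esum B (n - 1).
Proof.
move=> /andP[n0 nB]; have n1 : 0 <= n by lia.
have e1 : n - 1 - 1 = n - 2 by lia.
have e2 : n - 2 - 1 = n - 3 by lia.
have e3 : n - 3 - 1 = n - 4 by lia.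
have e4 : n - 4 - 1 = n - 5 by lia.
have r1 : q ^ n * dsum B 1 3 (n - 1) = q * (dsum B 3 6 (n - 1) - dsum B 3 6 (n - 2)).
  by rewrite -e1; apply: (expz_dsum B 1 3 1 n1).
have r2 : q ^ n * dsum B 1 3 (n - 2)
    = q ^+ 2 * (dsum B 3 6 (n - 2) - dsum B 3 6 (n - 3)).
  by rewrite -e2; apply: (expz_dsum B 1 3 2 n1).
have r3 : q ^ n * dsum B 5 9 (n - 3)
    = q ^+ 3 * (dsum B 7 12 (n - 3) - dsum B 7 12 (n - 4)).
  by rewrite -e3; apply: (expz_dsum B 5 9 3 n1).
have r4 : q ^ n * dsum B 5 9 (n - 4)
    = q ^+ 4 * (dsum B 7 12 (n - 4) - dsum B 7 12 (n - 5)).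
  by rewrite -e4; apply: (expz_dsum B 5 9 4 n1).
have ez : q ^ n * (q ^ (n - 1) * esum B (n - 1))
    = q * (dsum B 3 6 (n - 1) - dsum B 3 6 (n - 2))
      - q ^+ 2 * (dsum B 3 6 (n - 2) - dsum B 3 6 (n - 3))
      - q ^+ 3 * (q ^+ 3 * (dsum B 7 12 (n - 3) - dsum B 7 12 (n - 4))
         - q ^+ 4 * (dsum B 7 12 (n - 4) - dsum B 7 12 (n - 5))).
  rewrite -r1 -r2 -r3 -r4 expz_esum; last by lia.
  by rewrite e1 !(addrAC n (- 1)) e2 e3; ring.
(* By [gsum_rec], the term q^n [esum B n] now cancels between the two sides. *)
have -> : q ^ n * gsum B (n - 1)
    = gsum B n - gsum B (n - 1) - q ^ n * esum B n by rewrite (@gsum_rec B n) ?n1//; ring.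
have -> : (1 - q ^ n * q ^ (n - 1)) * esum B (n - 1)
    = esum B (n - 1) - q ^ n * (q ^ (n - 1) * esum B (n - 1)) by ring.
rewrite ez /gsum /esum e1.
rewrite !(addrAC n (- 1)) e2 e3 e4.
by ring.
Qed.
End DoubleSum.

(** * Recurrences for the bilateral sums and the seed identity *)

Lemma jacobi3_sum3 (j : int) : jacobi3 j + jacobi3 (j + 1) + jacobi3 (j + 2) = 0.
Proof.
by rewrite /jacobi3; repeat case: ifP => ?; lia.
Qed.

Section BilateralSum.
Variables (F : fieldType) (q : F).
Hypothesis hq : forall k : nat, (0 < k)%N -> q ^+ k != 1.

Local Arguments qfact_inv : simpl never.
Local Notation qf := (qfact_inv q).

(** The range -J <= j < J is stable under the symmetry j -> -1 - j; for J = L + 1 it is the range of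
    the theorem. *)
Definition zsum (J : nat) (h : int -> F) : F :=
  \sum_(i < J.*2) h (i%:Z - J%:Z).

Lemma zsum_shift J h : h (- J%:Z) = 0 -> h J%:Z = 0 ->
  zsum J (fun j => h (j + 1)) = zsum J h.
Proof.
move=> h0 h1; rewrite /zsum.
have : \sum_(i < J.*2.+1) h (i%:Z - J%:Z)
  = \sum_(i < J.*2) h (i%:Z - J%:Z) + h (J.*2%:Z - J%:Z) by rewrite big_ord_recr.
rewrite big_ord_recl /= sub0r h0 add0r (_ : J.*2%:Z - J%:Z = J); last by lia.
rewrite h1 addr0 => <-; apply: eq_bigr => i _; congr h.
by rewrite /bump /=; lia.
Qed.

Lemma zsumD J h h' : zsum J (fun j => h j + h' j) = zsum J h + zsum J h'.
Proof. exact: big_split. Qed.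

Lemma mulr_zsumr J c h : c * zsum J h = zsum J (fun j => c * h j).
Proof. exact: mulr_sumr. Qed.

Lemma eq_zsum J h h' : h =1 h' -> zsum J h = zsum J h'.
Proof. by move=> e; apply: eq_bigr => i _. Qed.

Lemma expz_ge0D (m n : int) : 0 <= m -> 0 <= n -> q ^ m * q ^ n = q ^ (m + n).
Proof. by move=> m0 n0; rewrite exprzD_ss ?m0 ?n0. Qed.

(* [kodd L] and [keven L] carry the binomials [2L+1, L-j] and [2L, L-j], divided by
   (q;q)_(2L+1) and (q;q)_(2L). *)
Definition kodd (L j : int) : F := q ^ (j ^+ 2 + j) * (qf (L - j) * qf (L + 1 + j)).
Definition keven (L j : int) : F := q ^ (j ^+ 2) * (qf (L - j) * qf (L + j)).

Lemma kodd_eq0 (L j : int) : (L < j) || (j < - L - 1) -> kodd L j = 0.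
Proof.
case/orP => h; rewrite /kodd; first by rewrite qfact_inv_neg ?(mulr0, mul0r)//; lia.
by rewrite (@qfact_inv_neg _ _ (_ + j)) ?(mulr0, mul0r)//; lia.
Qed.

Lemma keven_eq0 (L j : int) : (L < j) || (j < - L) -> keven L j = 0.
Proof.
case/orP => h; rewrite /keven; first by rewrite qfact_inv_neg ?(mulr0, mul0r)//; lia.
by rewrite (@qfact_inv_neg _ _ (_ + j)) ?(mulr0, mul0r)//; lia.
Qed.

(** With u = L - j and v = L + 1 + j, this is 1 - q^(u+v) = q^u (1 - q^v) + q^v (1 - q^u) + (1 -
    q^u)(1 - q^v), each factor lowering one q-factorial. *)
Lemma kodd_rec (L : nat) (j : int) :
  (1 - q ^+ L.*2.+1) * kodd L j
  = q ^+ L * (keven L j + keven L (j + 1)) + kodd (L%:Z - 1) j.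
Proof.
(* Off the support all terms vanish; on it u and v are non-negative, so the exponents add even if q
   = 0. *)
have [jL|jL] := ltP L%:Z j; first by rewrite !(keven_eq0, kodd_eq0); try lia; ring.
have [Lj|Lj] := ltP j (- L%:Z - 1); first by rewrite !(keven_eq0, kodd_eq0); try lia; ring.
have e0 : L%:Z - (j + 1) = L%:Z - j - 1 by ring.
have e1 : L%:Z - 1 - j = L%:Z - j - 1 by ring.
have e2 : L%:Z - 1 + 1 + j = L%:Z + 1 + j - 1 by ring.
have e3 : L%:Z + (j + 1) = L%:Z + 1 + j by ring.
have e4 : L%:Z + j = L%:Z + 1 + j - 1 by ring.
rewrite /kodd /keven e0 e1 e2 e3 e4 -!(qfact_inv_rec hq).
have u0 : 0 <= L%:Z - j by lia.
have v0 : 0 <= L%:Z + 1 + j by lia.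
have j0 : 0 <= j ^+ 2 + j by nia.
have p1 : q ^ (j ^+ 2 + j) * q ^ (L%:Z - j) = q ^+ L * q ^ (j ^+ 2).
  by rewrite [q ^+ L]exprnP !expz_ge0D ?sqr_ge0//; congr (_ ^ _); ring.
have p2 : q ^ (j ^+ 2 + j) * q ^ (L%:Z + 1 + j) = q ^+ L * q ^ ((j + 1) ^+ 2).
  by rewrite [q ^+ L]exprnP !expz_ge0D ?sqr_ge0//; congr (_ ^ _); ring.
have p3 : q ^+ L.*2.+1 = q ^ (L%:Z - j) * q ^ (L%:Z + 1 + j).
  by rewrite exprnP !expz_ge0D//; congr (_ ^ _); lia.
rewrite p3 mulrDr !mulrA -p1 -p2.
by ring.
Qed.

(** The same splitting with u = L - j and v = L + j. *)
Lemma keven_rec (L : nat) (j : int) : (0 < L)%N ->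
  (1 - q ^+ L.*2) * keven L j
  = q ^+ L * (kodd (L%:Z - 1) j + kodd (L%:Z - 1) (j - 1)) + keven (L%:Z - 1) j.
Proof.
move=> L0.
have [jL|jL] := ltP L%:Z j; first by rewrite !(keven_eq0, kodd_eq0); try lia; ring.
have [Lj|Lj] := ltP j (- L%:Z); first by rewrite !(keven_eq0, kodd_eq0); try lia; ring.
have e0 : L%:Z - 1 - (j - 1) = L%:Z - j by ring.
have e1 : L%:Z - 1 - j = L%:Z - j - 1 by ring.
have e2 : L%:Z - 1 + 1 + j = L%:Z + j by ring.
have e3 : L%:Z - 1 + 1 + (j - 1) = L%:Z + j - 1 by ring.
have e4 : L%:Z - 1 + j = L%:Z + j - 1 by ring.
rewrite /kodd /keven e0 e1 e2 e3 e4 -!(qfact_inv_rec hq).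
have u0 : 0 <= L%:Z - j by lia.
have v0 : 0 <= L%:Z + j by lia.
have j0 : 0 <= j ^+ 2 + j by nia.
have j1 : 0 <= (j - 1) ^+ 2 + (j - 1) by nia.
have p1 : q ^ (j ^+ 2) * q ^ (L%:Z - j) = q ^+ L * q ^ ((j - 1) ^+ 2 + (j - 1)).
  by rewrite [q ^+ L]exprnP !expz_ge0D ?sqr_ge0//; congr (_ ^ _); ring.
have p2 : q ^ (j ^+ 2) * q ^ (L%:Z + j) = q ^+ L * q ^ (j ^+ 2 + j).
  by rewrite [q ^+ L]exprnP !expz_ge0D ?sqr_ge0//; congr (_ ^ _); ring.
have p3 : q ^+ L.*2 = q ^ (L%:Z - j) * q ^ (L%:Z + j).
  by rewrite exprnP !expz_ge0D//; congr (_ ^ _); lia.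
rewrite p3 mulrDr !mulrA -p1 -p2.
by ring.
Qed.

Local Notation w j := ((jacobi3 j)%:~R : F).

Lemma jac_sum3 j : w j + w (j + 1) + w (j + 2) = 0.
Proof. by rewrite -!intrD jacobi3_sum3. Qed.

Definition gbil J (L : int) := zsum J (fun j => w (j + 1) * kodd L j).
Definition ebil J (L : int) := zsum J (fun j => (w j + w (j + 1)) * keven L j).

(** Sum [kodd_rec] against w (j+1): the shift j+1 -> j gives one [keven] term the weight w j, which
    completes the weight of [ebil]. *)
Lemma gbil_rec J (L : nat) : (L < J)%N ->
  (1 - q ^+ L.*2.+1) * gbil J L = q ^+ L * ebil J L + gbil J (L%:Z - 1).
Proof.
move=> LJ; have sh : zsum J (fun j => w (j + 1) * keven L (j + 1))
    = zsum J (fun j => w j * keven L j).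
  by rewrite (@zsum_shift J (fun j => w j * keven L j))// keven_eq0 ?mulr0//; lia.
transitivity (q ^+ L * (zsum J (fun j => w (j + 1) * keven L j)
    + zsum J (fun j => w (j + 1) * keven L (j + 1))) + gbil J (L%:Z - 1)).
  rewrite /gbil mulr_zsumr -zsumD mulr_zsumr -zsumD; apply: eq_zsum => j.
  by rewrite mulrCA kodd_rec; ring.
rewrite sh -zsumD; congr (_ * _ + _).
by apply: eq_zsum => j; ring.
Qed.

(** After the shift the weight is w j + 2 w (j+1) + w (j+2), which is w (j+1) because three
    consecutive symbols sum to 0. *)
Lemma ebil_rec J (L : nat) : (0 < L < J)%N ->
  (1 - q ^+ L.*2) * ebil J L = q ^+ L * gbil J (L%:Z - 1) + ebil J (L%:Z - 1).
Proof.
move=> /andP[L0 LJ].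
have sh : zsum J (fun j => (w j + w (j + 1)) * kodd (L%:Z - 1) (j - 1))
    = zsum J (fun j => (w (j + 1) + w (j + 2)) * kodd (L%:Z - 1) j).
  rewrite -(@zsum_shift J (fun j => (w j + w (j + 1)) * kodd (L%:Z - 1) (j - 1))).
  - by apply: eq_zsum => j; rewrite -addrA addrK.
  - by rewrite kodd_eq0 ?mulr0//; lia.
  - by rewrite kodd_eq0 ?mulr0//; lia.
transitivity (q ^+ L * (zsum J (fun j => (w j + w (j + 1)) * kodd (L%:Z - 1) j)
    + zsum J (fun j => (w j + w (j + 1)) * kodd (L%:Z - 1) (j - 1)))
    + ebil J (L%:Z - 1)).
  rewrite /ebil mulr_zsumr -zsumD mulr_zsumr -zsumD; apply: eq_zsum => j.
  by rewrite mulrCA keven_rec//; ring.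
rewrite sh -zsumD; congr (_ * _ + _); apply: eq_zsum => j.
rewrite -mulrDl; congr (_ * _).
by rewrite -[RHS]addr0 -(jac_sum3 j); ring.
Qed.

Lemma gbil_neg1 J : gbil J (- 1) = 0.
Proof.
apply: big1 => i _; rewrite kodd_eq0 ?mulr0//.
by case: (leqP J i) => ?; apply/orP; [left|right]; lia.
Qed.

Lemma qpoch0 (a p : F) : qpoch a p 0 = 1.
Proof. by rewrite /qpoch big_geq. Qed.

Lemma ebil0 J : (0 < J)%N -> ebil J 0 = 1.
Proof.
(* The index [J] stands for j = 0, the only surviving term, of weight 0 + 1. *)
move=> J0; have h : (J < J.*2)%N by lia.
rewrite /ebil /zsum (bigD1 (Ordinal h)) //= big1 => [|i iJ].
  by rewrite subrr /keven !qfact_invE !qpoch0 expr0z !addr0 invr1 !mulr1 add0r.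
rewrite keven_eq0 ?mulr0//.
have : i != J :> nat by [].
by lia.
Qed.

Lemma esum0 B : esum q B 0 = 1.
Proof.
rewrite /esum !(@dsum_neg _ _ _ _ _ (_ - _)) // !mulr0 subr0 !addr0.
rewrite /dsum big_ord_recl [X in _ + X]big1 => [|m _]; last first.
  by apply: big1 => k _; rewrite dterm_neg// lift0; lia.
rewrite addr0 big_ord_recl [X in _ + X]big1 => [|k _]; last first.
  by rewrite dterm_neg// lift0; lia.
by rewrite addr0 /dterm /= qfact_invE !qpoch0 expr0 mulr1 invr1 !mulr1.
Qed.

Lemma bilateral_double_sum B J (L : nat) : (L <= B)%N -> (L < J)%N ->
  ebil J L = qpoch q q L * esum q B L * qf L.*2 /\
  gbil J L = qpoch q q L * gsum q B L * qf L.*2.+1.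
Proof.
(* The value of G at n needs E at n and G at n - 1. The premise on n - 1 is normalised by (q;q)_n (1
   + q^n)/(q;q)_(2n), so that it also covers n = 0, where both sides are 0. *)
have gstep n : (n < J)%N -> (n <= B)%N ->
    ebil J n = qpoch q q n * esum q B n * qf n.*2 ->
    gbil J (n%:Z - 1) = qpoch q q n * (1 + q ^+ n) * gsum q B (n%:Z - 1) * qf n.*2 ->
    gbil J n = qpoch q q n * gsum q B n * qf n.*2.+1.
  move=> nJ nB eE eG; apply: (mulfI (one_sub_expr_neq0 hq (ltn0Sn n.*2))).
  rewrite gbil_rec// eE eG [in RHS]mulrCA qfact_inv_recS//.
  rewrite (@gsum_rec _ _ hq B n) ?lez_nat// -!exprnP.
  by ring.
elim: L => [|L IH] LB LJ.
  split; last apply: gstep => //.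
  - by rewrite ebil0// esum0 qfact_invE qpoch0 invr1 !mulr1.
  - by rewrite ebil0// esum0 qfact_invE qpoch0 invr1 !mulr1.
  - by rewrite sub0r gbil_neg1 /gsum !dsum_neg// mulr0 addr0 mulr0 mul0r.
have [eE eG] := IH (ltnW LB) (ltnW LJ).
have LS : L.+1%:Z - 1 = L by lia.
have h1 : ebil J L.+1 = qpoch q q L.+1 * esum q B L.+1 * qf L.+1.*2.
  have n0 : (0 < L.+1.*2)%N by [].
  apply: (mulfI (one_sub_expr_neq0 hq n0)).
  rewrite ebil_rec// LS eE eG [in RHS]mulrCA [in RHS]doubleS qfact_inv_recS//.
  have := @esum_rec _ _ hq B L.+1; rewrite LS -!exprnP -exprD => rec.
  rewrite qpochS -exprS -[_ * _ * esum _ _ _]mulrA rec; last by lia.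
  rewrite -(qfact_inv_recS hq L.*2) addSn addnn.
  by ring.
split => //; apply: gstep => //.
rewrite LS eG -(qfact_inv_recS hq L.*2.+1) qpochS -doubleS -exprS -addnn exprD.
by ring.
Qed.
End BilateralSum.

(** * Sums over tuples and the iterated Bailey lemma *)

Lemma sum_tuple_cons (V : nmodType) (T : finType) (f : nat) (h : f.+1.-tuple T -> V) :
  \sum_t h t = \sum_(x : T) \sum_(t : f.-tuple T) h (cons_tuple x t).
Proof.
rewrite pair_big /= (reindex (fun p : T * f.-tuple T => cons_tuple p.1 p.2)) //=.
exists (fun t => (thead t, behead_tuple t)) => [[x t]|t] _ /=.
  by congr (_, _); apply: val_inj.
by apply: val_inj; rewrite /= [in RHS](tuple_eta t).
Qed.

Lemma sum_tuple0 (V : nmodType) (T : finType) (h : 0.-tuple T -> V) :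
  \sum_t h t = h [tuple].
Proof.
by rewrite (bigD1 [tuple]) //= big1 ?addr0// => t; rewrite [t]tuple0 => /eqP.
Qed.

Section Tuples.
Variable f : nat.
Implicit Type s : f.-tuple nat.

Lemma part_cons1 n s : part (cons_tuple n s) 1 = n.
Proof. by []. Qed.

Lemma part_consS n s i : (0 < i)%N -> part (cons_tuple n s) i.+1 = part s i.
Proof. by case: i. Qed.

Lemma tailsum_consS n s i : (0 < i)%N ->
  tailsum (cons_tuple n s) i.+1 = tailsum s i.
Proof.
move=> i0; rewrite /tailsum big_add1 /=; apply: eq_big_nat => k /andP[ik _].
by rewrite part_consS//; apply: leq_trans ik.
Qed.

Lemma tailsum_cons1 n s : tailsum (cons_tuple n s) 1 = (n + tailsum s 1)%N.
Proof.
rewrite {1}/tailsum big_ltn// part_cons1; congr (_ + _)%N.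
exact: (@tailsum_consS n s 1).
Qed.
End Tuples.

Section BaileyChain.
Variables (F : fieldType) (q : F).
Hypothesis hq : forall k : nat, (0 < k)%N -> q ^+ k != 1.

Local Arguments qfact_inv : simpl never.
Local Notation qf := (qfact_inv q).

Variables (J : nat) (a : int -> F).

(** The beta side of a Bailey pair relative to a = q, in bilateral form; [p] counts the factors
    q^(j^2+j) gathered so far. *)
Definition bailey_beta (p : nat) (r : int) : F :=
  zsum J (fun j => a j * q ^ (p%:Z * (j ^+ 2 + j)) * (qf (r - j) * qf (r + 1 + j))).

Lemma bailey_step B p (L : nat) : (L <= B)%N ->
  \sum_(r < B.+1) q ^+ (r ^ 2 + r) * qf (L%:Z - r%:Z) * bailey_beta p r
  = bailey_beta p.+1 L.
Proof.
move=> LB; under eq_bigr => r _ do rewrite mulr_zsumr /zsum.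
rewrite exchange_big /=; apply: eq_bigr => i _.
set j := i%:Z - J%:Z.
under eq_bigr => r _ do rewrite mulrCA.
rewrite -mulr_sumr bailey_kernel// !mulrA; do 2 congr (_ * _).
have j0 : 0 <= j ^+ 2 + j by clearbody j; nia.
rewrite -mulrA expz_ge0D ?mulr_ge0//.
by congr (_ * (_ ^ _)); rewrite intS mulrDl mul1r addrC.
Qed.

(** The function [b] stands for the remaining factors at n_f. The factor 1/(q;q)_(L-N_1) is kept
    apart because [L] changes along the chain. *)
Definition chain_weight (b : int -> F) (f : nat) (s : f.-tuple nat) : F :=
  q ^+ (\sum_(1 <= i < f.+1) tailsum s i ^ 2 + \sum_(1 <= i < f.+1) tailsum s i)
  / (\prod_(1 <= i < f) qpoch q q (part s i)) * b (part s f).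

Lemma chain_weight_cons b f n (s : f.-tuple nat) : (0 < f)%N ->
  chain_weight b (cons_tuple n s)
  = q ^+ ((n + tailsum s 1) ^ 2 + (n + tailsum s 1)) * qf n * chain_weight b s.
Proof.
move=> f0; rewrite /chain_weight.
have sumS (h : nat -> nat) : (\sum_(1 <= i < f.+2) h (tailsum (cons_tuple n s) i)
    = h (n + tailsum s 1) + \sum_(1 <= i < f.+1) h (tailsum s i))%N.
  rewrite big_ltn// tailsum_cons1 big_add1; congr (_ + _)%N.
  by apply: eq_big_nat => i /andP[i0 _]; rewrite tailsum_consS.
rewrite (sumS (fun x => x ^ 2)%N) (sumS id) part_consS//.
rewrite [\prod_(1 <= i < f.+1) _]big_ltn// part_cons1 [\prod_(2 <= i < _) _]big_add1 /=.
rewrite (eq_big_nat _ _ (F2 := fun i => qpoch q q (part s i))); last first.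
  by move=> i /andP[i0 _]; rewrite part_consS.
by rewrite addnACA exprD invfM qfact_invE; ring.
Qed.

(** Induction on the length: for r = N_1 the factor 1/(q;q)_(n_1) is 1/(q;q)_(r-N_2), just what the
    shorter chain at r requires, so each entry costs one [bailey_step]. *)
Lemma bailey_chain B p f (L : nat) : (L <= B)%N ->
  \sum_(t : f.+1.-tuple 'I_B.+1)
     qf (L%:Z - (tailsum (map_tuple val t) 1)%:Z)
     * chain_weight (bailey_beta p) (map_tuple val t)
  = bailey_beta (p + f.+1) L.
Proof.
elim: f L => [|f IH] L LB; rewrite sum_tuple_cons.
  rewrite addn1 -(bailey_step _ LB); apply: eq_bigr => n _.
  rewrite sum_tuple0 /chain_weight /tailsum !big_nat1 big_geq// invr1 mulr1.
  by rewrite mulrA [qf _ * _]mulrC.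
rewrite addnS -(bailey_step _ LB).
under [RHS]eq_bigr => r _.
  rewrite -IH; last by case: r.
  by rewrite mulr_sumr; over.
rewrite exchange_big [RHS]exchange_big /=; apply: eq_bigr => t _.
set s := map_tuple val t; set N := tailsum s 1.
pose H (r : nat) := q ^+ (r ^ 2 + r) * qf (L%:Z - r%:Z).
transitivity (chain_weight (bailey_beta p) s * \sum_(n < B.+1) H (n + N)%N * qf n).
  rewrite mulr_sumr; apply: eq_bigr => n _.
  rewrite (_ : map_tuple val (cons_tuple n t) = cons_tuple (val n) s); last exact: val_inj.
  by rewrite chain_weight_cons// tailsum_cons1 /H -/N; ring.
transitivity (chain_weight (bailey_beta p) s * \sum_(r < B.+1) H r * qf (r%:Z - N%:Z));
  last by rewrite mulr_sumr; apply: eq_bigr => r _; rewrite /H; ring.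
congr (_ * _).
(* Substituting r = n + N within the fixed range loses the terms n > B - N, where [H] is 0 since L
   <= B, and gains r < N, where 1/(q;q)_(r-N) is 0. *)
have H0 r : (B < r)%N -> H r = 0.
  by move=> Br; rewrite /H qfact_inv_neg ?mulr0//; lia.
have [NB|NB] := leqP N B; last first.
  rewrite [LHS]big1 => [|r _]; last by rewrite H0 ?mul0r//; lia.
  rewrite big1// => r _.
  by rewrite qfact_inv_neg ?mulr0//; have := ltn_ord r; lia.
rewrite [in RHS](_ : B.+1 = (N + (B.+1 - N))%N); last by lia.
rewrite [in LHS](_ : B.+1 = ((B.+1 - N) + N)%N); last by lia.
rewrite !big_split_ord /= [X in _ + X = _]big1 => [|i _]; last first.
  by rewrite H0 ?mul0r//; lia.
rewrite [X in _ = X + _]big1 => [|i _]; last first.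
  by rewrite qfact_inv_neg ?mulr0//; have := ltn_ord i; lia.
rewrite addr0 add0r; apply: eq_bigr => i _; rewrite addnC; congr (_ * qf _).
by lia.
Qed.
End BaileyChain.

(** * From finitely supported sums to sums over finite types *)

Lemma fsbig_finType (V : nmodType) (T : finType) (I : choiceType) (g : T -> I)
    (h : I -> V) :
  injective g -> (forall i, (forall t, g t <> i) -> h i = 0) ->
  \sum_(i \in [set: I]) h i = \sum_(t : T) h (g t).
Proof.
move=> ginj h0.
rewrite -(@fsbig_widen _ _ _ _ (g @` setT)) //; last first.
  by move=> i [_ nig] /=; apply: h0 => t gt; apply: nig; exists t.
rewrite fsbig_image; last by move=> x y _ _; exact: ginj.
rewrite (@fsbig_fwiden _ _ _ _ (index_enum T)) ?index_enum_uniq//.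
- by move=> t _ /=; rewrite mem_index_enum.
- by move=> t [_] /=; case.
Qed.

Lemma fsbig_box (V : nmodType) (L f : nat) (h : nat * nat * f.-tuple nat -> V) :
  (forall m n s, (L < m)%N || (L < n)%N || (L < tailsum s 1)%N -> h (m, n, s) = 0) ->
  \sum_(t \in [set: nat * nat * f.-tuple nat]) h t =
  \sum_(s : f.-tuple 'I_L.+1) \sum_(m < L.+1) \sum_(n < L.+1)
     h (val m, val n, map_tuple val s).
Proof.
move=> h0.
pose g (u : f.-tuple 'I_L.+1 * ('I_L.+1 * 'I_L.+1)) : nat * nat * f.-tuple nat :=
  (val u.2.1, val u.2.2, map_tuple val u.1).
rewrite (@fsbig_finType _ _ _ g).
- under [RHS]eq_bigr do rewrite pair_bigA.
  by rewrite pair_bigA.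
- move=> [s [m n]] [s' [m' n']] [/val_inj -> /val_inj -> /(inj_map val_inj) ss].
  by congr (_, _); apply: val_inj.
- move=> [[m n] s] ng; apply: h0; apply/negPn/negP.
  rewrite !negb_or -!leqNgt => /andP[/andP[mL nL] sL].
  (* Every n_i is at most N_1 <= L, so [inord] preserves the entries. *)
  apply: (ng (map_tuple inord s, (inord m, inord n))).
  rewrite /g /= !inordK ?ltnS//; congr (_, _, _).
  apply: val_inj; rewrite /= -map_comp -[RHS]map_id.
  apply/eq_in_map => x /(nthP 0%N)[i]; rewrite size_tuple => lif <- /=.
  rewrite inordK// ltnS; apply: leq_trans sL.
  exact: (@part_le_tailsum1 _ s i.+1).
Qed.

Lemma fsbig_zsum (F : fieldType) (L : nat) (h : int -> F) :
  \sum_(j \in [set j : int | - L%:Z - 1 <= j <= L%:Z]) h j = zsum L.+1 h.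
Proof.
rewrite /zsum; have [n nE] : exists n, n = L.+1.*2 by eexists.
rewrite -nE (@fsbig_fwiden _ _ _ _ [seq i%:Z - L.+1%:Z | i <- index_iota 0 n]).
- by rewrite big_map big_mkord.
- move=> j /= jL; apply/mapP; exists (absz ((j : int) + L.+1%:Z)); last by lia.
  by rewrite mem_index_iota; lia.
- by rewrite map_inj_uniq ?iota_uniq// => x y; lia.
- by move=> j [/= /mapP[i]]; rewrite mem_index_iota => iL -> []; lia.
Qed.

Lemma qbinomE (F : fieldType) (q : F) (t : nat) (b : int) :
  qbinom q t b = qpoch q q t * (qfact_inv q b * qfact_inv q (t%:Z - b)).
Proof.
rewrite /qbinom; case: b => [m|m]; last by rewrite mul0r mulr0.
case E: (t%:Z - m%:Z) => [n|n]; last by rewrite mulr0 mulr0.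
by rewrite (_ : t = m + n)%N; [rewrite invfM|lia].
Qed.

(** * Factorization of the summands and proof of the identity *)

Section SummandFactorization.
Variables (F : fieldType) (q : F) (L f : nat).
Local Arguments qfact_inv : simpl never.
Local Notation qf := (qfact_inv q).

Lemma summand1E m n (s : f.-tuple nat) :
  summand1 q L m n s = qpoch q q (2 * L + 1) * (qf (L%:Z - (tailsum s 1)%:Z)
    * chain_weight q (fun c => qpoch q q `|c|%N * dterm q 1 3 c m n
                               * qf (`|c|.*2.+1)%N) s).
Proof.
rewrite /summand1 /chain_weight /dterm /= -addnA exprD.
rewrite (_ : (2 * part s f + 1)%N = (part s f).*2.+1); last by lia.
rewrite mul1n qfact_invE !invfM; ring.
Qed.

Lemma summand2E m n (s : f.-tuple nat) :
  summand2 q L m n s = qpoch q q (2 * L + 1) * (qf (L%:Z - (tailsum s 1)%:Z)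
    * chain_weight q (fun c => qpoch q q `|c|%N * dterm q 3 6 (c - 1) m n
                               * qf (`|c|.*2.+1)%N) s).
Proof.
rewrite /summand2 /chain_weight /dterm /= -addnA exprD.
rewrite (_ : (2 * part s f + 1)%N = (part s f).*2.+1); last by lia.
rewrite (_ : _ - 1 - _ - _ = (part s f)%:Z - 3 * n%:Z - 2 * m%:Z - 1); last by lia.
rewrite qfact_invE !invfM; ring.
Qed.

Lemma sum_summand1 B (s : f.-tuple nat) :
  \sum_(m < B.+1) \sum_(n < B.+1) summand1 q L m n s
  = qpoch q q (2 * L + 1) * (qf (L%:Z - (tailsum s 1)%:Z)
    * chain_weight q (fun c => qpoch q q `|c|%N * dsum q B 1 3 c
                               * qf (`|c|.*2.+1)%N) s).
Proof.
rewrite /chain_weight /dsum !(mulr_sumr, mulr_suml); apply: eq_bigr => m _.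
rewrite !(mulr_sumr, mulr_suml); apply: eq_bigr => n _.
exact: summand1E.
Qed.

Lemma sum_summand2 B (s : f.-tuple nat) :
  \sum_(m < B.+1) \sum_(n < B.+1) summand2 q L m n s
  = qpoch q q (2 * L + 1) * (qf (L%:Z - (tailsum s 1)%:Z)
    * chain_weight q (fun c => qpoch q q `|c|%N * dsum q B 3 6 (c - 1)
                               * qf (`|c|.*2.+1)%N) s).
Proof.
rewrite /chain_weight /dsum !(mulr_sumr, mulr_suml); apply: eq_bigr => m _.
rewrite !(mulr_sumr, mulr_suml); apply: eq_bigr => n _.
exact: summand2E.
Qed.

(** If N_1 <= L, then n_f <= L is below m or n, hence below 3n + 2m, and [b] vanishes. *)
Lemma chain_weight_box b (m n : nat) (s : f.-tuple nat) :
  (0 < f)%N -> (forall c : int, c < 3 * n%:Z + 2 * m%:Z -> b c = 0) ->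
  (L < m)%N || (L < n)%N || (L < tailsum s 1)%N ->
  qf (L%:Z - (tailsum s 1)%:Z) * chain_weight q b s = 0.
Proof.
move=> f0 b0 h; have [Ls|sL] := ltnP L (tailsum s 1).
  by rewrite qfact_inv_neg ?mul0r//; lia.
have := @part_le_tailsum1 _ s f; rewrite f0 leqnn => /(_ isT) fs.
by rewrite /chain_weight b0 ?mulr0//; lia.
Qed.
End SummandFactorization.

(* The sum over j starts at -L-1 (not -L): without the j = -L-1 term, which is
   (-L/3) q^((f+1)(L^2+L)), the identity fails whenever 3 does not divide L. *)
Theorem theorem26 (F : fieldType) (q : F)
    (hq : forall k : nat, (0 < k)%N -> q ^+ k != 1)
    (L f : nat) (hf : (0 < f)%N) :
  \sum_(t \in [set: nat * nat * f.-tuple nat]) summand1 q L t.1.1 t.1.2 t.2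
  + q * \sum_(t \in [set: nat * nat * f.-tuple nat])
          summand2 q L t.1.1 t.1.2 t.2
  = \sum_(j \in [set j : int | - L%:Z - 1 <= j <= L%:Z])
      (jacobi3 (j + 1))%:~R * q ^ ((f + 1)%:Z * (j ^+ 2 + j))
      * qbinom q (2 * L%:Z + 1) (L%:Z - j).
Proof.
rewrite (@fsbig_box _ L); last first.
  move=> m n s h; rewrite summand1E (@chain_weight_box _ _ _ _ _ m n) ?mulr0// => c cmn.
  by rewrite dterm_neg// mulr0 mul0r.
rewrite (@fsbig_box _ L); last first.
  move=> m n s h; rewrite summand2E (@chain_weight_box _ _ _ _ _ m n) ?mulr0// => c cmn.
  by rewrite dterm_neg ?mulr0 ?mul0r//=; lia.
pose a (j : int) : F := (jacobi3 (j + 1))%:~R.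
have LL := leqnn L.
apply: etrans (esym (fsbig_zsum L _)).
rewrite mulr_sumr -big_split /=.
transitivity (qpoch q q (2 * L + 1) * bailey_beta q L.+1 a (f + 1) L); last first.
  rewrite /bailey_beta mulr_zsumr; apply: eq_zsum => j.
  rewrite (_ : 2 * L%:Z + 1 = (2 * L + 1)%N) // qbinomE.
  by rewrite (_ : (2 * L + 1)%:Z - _ = L%:Z + 1 + j); [ring | lia].
case: f hf => // f' _.
(* The seed already carries one factor q^(j^2+j), so the chain starts at p = 1 and its f steps reach
   f + 1. *)
rewrite (addnC f'.+1 1%N) -(@bailey_chain _ _ hq L.+1 a L 1 f' L LL).
rewrite mulr_sumr; apply: eq_bigr => t _; set s := map_tuple val t.
rewrite sum_summand1 sum_summand2 [q * (_ * _)]mulrCA -mulrDr; congr (_ * _).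
have [sL|sL] := ltnP L (tailsum s 1).
  by rewrite qfact_inv_neg ?(mul0r, mulr0, addr0)//; lia.
rewrite [q * (_ * _)]mulrCA -mulrDr; congr (_ * _); rewrite /chain_weight [q * (_ * _)]mulrCA -mulrDr.
congr (_ * _); set c := part s f'.+1.
have cL : (c <= L)%N by apply: leq_trans sL; apply: part_le_tailsum1; rewrite leqnn.
(* The seed identity is applied at n_f, which is at most L once N_1 <= L. *)
have [_] := @bilateral_double_sum _ _ hq L L.+1 c cL cL.
have -> : gbil q L.+1 c = bailey_beta q L.+1 a 1 c.
  by apply: eq_zsum => j; rewrite /kodd [LHS]mulrA; congr (_ * q ^ _ * _); ring.
by move=> ->; rewrite /gsum /=; ring.
Qed.
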